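(* Let $m$ be a positive integer, $\lambda$ a nonzero real number, and $k\ge 0$ an integer. Then, as formal power series in $t$, $$e_{\lambda}(t)\,\frac{1}{k!}\left(\frac{e_{\lambda}^{m}(t)-1}{m}\right)^{k}=\sum_{n=k}^{\infty}W_{m,\lambda}(n,k)\frac{t^{n}}{n!}.$$
   Context: For a nonzero real $\lambda$: $(x)_{0,\lambda}=1$, $(x)_{n,\lambda}=x(x-\lambda)\cdots(x-(n-1)\lambda)$ for $n\ge1$; $(x)_n=(x)_{n,1}$ is the usual falling factorial. The degenerate exponential is $e_\lambda^x(t)=(1+\lambda t)^{x/\lambda}=\sum_{n\ge0}(x)_{n,\lambda}t^n/n!$, and $e_\lambda(t)=e_\lambda^1(t)$. The degenerate Whitney numbers of the second kind $W_{m,\lambda}(n,k)$ ($0\le k\le n$) are defined by the polynomial identity $(mx+1)_{n,\lambda}=\sum_{k=0}^{n}W_{m,\lambda}(n,k)m^{k}(x)_{k}$ for $n\ge0$. *)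

(* Defs.v *)
From HB Require Import structures.
From mathcomp Require Import all_boot all_order all_algebra.
From mathcomp Require Import boolp reals.

Set Implicit Arguments.
Unset Strict Implicit.
Unset Printing Implicit Defensive.

Import GRing.Theory Num.Theory.
Local Open Scope ring_scope.

(* Formal power series over R, given by their coefficients; a record rather
   than a bare function type, so that the Cauchy product below cannot be
   confused with the pointwise product of functions. *)
Record fps (R : Type) := FPS { fps_coef : nat -> R }.

Notation "\fps_ n E" := (FPS (fun n => E))
  (at level 36, n name, E at level 36, format "\fps_ n  E") : ring_scope.

HB.instance Definition _ (R : Type) := gen_eqMixin (fps R).
HB.instance Definition _ (R : Type) := gen_choiceMixin (fps R).

Lemma fpsP (R : Type) (f g : fps R) : fps_coef f =1 fps_coef g <-> f = g.
Proof.
split=> [|-> //]; case: f g => [f] [g] /= fg.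
by congr FPS; apply: funext.
Qed.

Section FpsZmod.
Variable R : zmodType.
Implicit Types f g h : fps R.

Definition fps_zero : fps R := \fps_n 0.
Definition fps_opp f : fps R := \fps_n (- fps_coef f n).
Definition fps_add f g : fps R := \fps_n (fps_coef f n + fps_coef g n).

Let fps_addA : associative fps_add.
Proof. by move=> f g h; apply/fpsP => n; rewrite /= addrA. Qed.
Let fps_addC : commutative fps_add.
Proof. by move=> f g; apply/fpsP => n; rewrite /= addrC. Qed.
Let fps_add0 : left_id fps_zero fps_add.
Proof. by move=> f; apply/fpsP => n; rewrite /= add0r. Qed.
Let fps_addN : left_inverse fps_zero fps_opp fps_add.
Proof. by move=> f; apply/fpsP => n; rewrite /= addNr. Qed.

HB.instance Definition _ :=
  GRing.isZmodule.Build (fps R) fps_addA fps_addC fps_add0 fps_addN.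

End FpsZmod.

Section FpsRing.
Variable R : comNzRingType.
Implicit Types f g h : fps R.

Definition fps_one : fps R := \fps_n (n == 0%N)%:R.
Definition fps_mul f g : fps R :=
  \fps_n (\sum_(j < n.+1) fps_coef f j * fps_coef g (n - j)).
Definition fps_scale (a : R) f : fps R := \fps_n (a * fps_coef f n).

Let trunc (N : nat) f : {poly R} := \poly_(i < N) fps_coef f i.

Let coef_trunc N f i : (i < N)%N -> (trunc N f)`_i = fps_coef f i.
Proof. by move=> iN; rewrite coef_poly iN. Qed.

Let coef_truncM N f g i : (i < N)%N ->
  fps_coef (fps_mul f g) i = (trunc N f * trunc N g)`_i.
Proof.
move=> iN; rewrite coefM /=; apply: eq_bigr => j _.
rewrite !coef_trunc //; first exact: leq_ltn_trans (leq_subr _ _) iN.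
by apply: leq_ltn_trans iN; rewrite -ltnS.
Qed.

Let fps_mulC : commutative fps_mul.
Proof.
by move=> f g; apply/fpsP => n; rewrite !(@coef_truncM n.+1) // mulrC.
Qed.

Let fps_mulA : associative fps_mul.
Proof.
move=> f g h; apply/fpsP => n.
transitivity ((trunc n.+1 f * (trunc n.+1 g * trunc n.+1 h))`_n).
  rewrite coefM; apply: eq_bigr => j _.
  by rewrite coef_trunc // (@coef_truncM n.+1) // ltnS leq_subr.
rewrite mulrA coefM; apply: eq_bigr => j _.
by rewrite (@coef_trunc _ h) ?ltnS ?leq_subr // (@coef_truncM n.+1).
Qed.

Let fps_mul1 : left_id fps_one fps_mul.
Proof.
move=> f; apply/fpsP => n; rewrite /= big_ord_recl /= mul1r subn0.
by rewrite big1 ?addr0 // => i _; rewrite mul0r.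
Qed.

Let fps_mulDl : left_distributive fps_mul (@fps_add R).
Proof.
move=> f g h; apply/fpsP => n; rewrite /= -big_split /=.
by apply: eq_bigr => i _; rewrite mulrDl.
Qed.

Let fps_oner_neq0 : fps_one != 0.
Proof.
apply/eqP => /(congr1 (fun f : fps R => fps_coef f 0%N)) /eqP.
by rewrite /= oner_eq0.
Qed.

HB.instance Definition _ := GRing.Zmodule_isComNzRing.Build (fps R)
  fps_mulA fps_mulC fps_mul1 fps_mulDl fps_oner_neq0.

Let fps_scaleA a b f : fps_scale a (fps_scale b f) = fps_scale (a * b) f.
Proof. by apply/fpsP => n; rewrite /= mulrA. Qed.
Let fps_scale1 : left_id 1 fps_scale.
Proof. by move=> f; apply/fpsP => n; rewrite /= mul1r. Qed.
Let fps_scaleDr : right_distributive fps_scale +%R.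
Proof. by move=> a f g; apply/fpsP => n; rewrite /= mulrDr. Qed.
Let fps_scaleDl f : {morph fps_scale^~ f : a b / a + b}.
Proof. by move=> a b; apply/fpsP => n; rewrite /= mulrDl. Qed.

HB.instance Definition _ := GRing.Zmodule_isLmodule.Build R (fps R)
  fps_scaleA fps_scale1 fps_scaleDr fps_scaleDl.

Let fps_scaleAl (a : R) f g : a *: (f * g) = a *: f * g.
Proof.
apply/fpsP => n; rewrite /= mulr_sumr.
by apply: eq_bigr => i _; rewrite mulrA.
Qed.

HB.instance Definition _ :=
  GRing.Lmodule_isLalgebra.Build R (fps R) fps_scaleAl.

Let fps_scaleAr (a : R) f g : a *: (f * g) = f * (a *: g).
Proof. by rewrite mulrC fps_scaleAl mulrC. Qed.

HB.instance Definition _ :=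
  GRing.Lalgebra_isAlgebra.Build R (fps R) fps_scaleAr.

Lemma fps_coef0 n : fps_coef (0 : fps R) n = 0.
Proof. by []. Qed.
Lemma fps_coef1 n : fps_coef (1 : fps R) n = (n == 0%N)%:R.
Proof. by []. Qed.
Lemma fps_coefD f g n : fps_coef (f + g) n = fps_coef f n + fps_coef g n.
Proof. by []. Qed.
Lemma fps_coefN f n : fps_coef (- f) n = - fps_coef f n.
Proof. by []. Qed.
Lemma fps_coefZ a f n : fps_coef (a *: f) n = a * fps_coef f n.
Proof. by []. Qed.
Lemma fps_coefM f g n :
  fps_coef (f * g) n = \sum_(j < n.+1) fps_coef f j * fps_coef g (n - j).
Proof. by []. Qed.

End FpsRing.

(* (x)_{n,lam}.  The ring A is arbitrary because x is taken both in the field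
   of scalars and, below, in its polynomial ring. *)
Definition degen_ffact (A : comNzRingType) (lam x : A) (n : nat) : A :=
  \prod_(i < n) (x - lam *+ i).

(* e_lam^x(t) = (1 + lam t)^(x / lam) as a power series in t. *)
Definition degen_exp (R : fieldType) (lam x : R) : fps R :=
  \fps_n (degen_ffact lam x n / n`!%:R).

(* The coefficients are those of the binomial expansion of
   (1 + lam t)^(x / lam). *)
Lemma degen_exp_binomial (R : fieldType) (lam x : R) (n : nat) : lam != 0 ->
  fps_coef (degen_exp lam x) n =
  degen_ffact 1 (x / lam) n / n`!%:R * lam ^+ n.
Proof.
move=> lam0; rewrite /= mulrAC; congr (_ / _).
have -> : lam ^+ n = \prod_(i < n) lam by rewrite prodr_const card_ord.
rewrite /degen_ffact -big_split /=.
apply: eq_bigr => i _; rewrite mulrBl divfK //.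
by rewrite mulr_natl.
Qed.

(* W n k is W_{m,lam}(n,k): the values with k <= n are pinned down by an
   identity of polynomials in 'X; those with k > n are left unconstrained. *)
Definition is_degen_whitney2 (R : fieldType) (m : nat) (lam : R)
    (W : nat -> nat -> R) : Prop :=
  forall n : nat,
    degen_ffact lam%:P (m%:R *: 'X + 1) n =
    \sum_(k < n.+1) (W n k * m%:R ^+ k) *: degen_ffact 1 'X k.

Lemma monic_degen_ffactX (R : fieldType) (k : nat) :
  degen_ffact 1 'X k \is @monic R.
Proof.
apply: monic_prod => i _.
by have := monicXsubC (i%:R : R); rewrite polyC_natr.
Qed.

Lemma size_degen_ffactX (R : fieldType) (k : nat) :
  size (degen_ffact 1 'X k : {poly R}) = k.+1.
Proof.
rewrite /degen_ffact (eq_bigr (fun i : 'I_k => 'X - (i%:R : R)%:P)).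
  by rewrite size_prod_XsubC /index_enum -enumT size_enum_ord.
by move=> i _; rewrite polyC_natr.
Qed.

Lemma degen_ffactX_span (R : fieldType) (n : nat) (p : {poly R}) :
  (size p <= n)%N ->
  exists c : nat -> R, p = \sum_(k < n) c k *: degen_ffact 1 'X k.
Proof.
elim: n p => [|n IHn] p.
  by rewrite size_poly_leq0 => /eqP->; exists (fun=> 0); rewrite big_ord0.
move=> sp; set q := p - p`_n *: degen_ffact 1 'X n.
have [|c cE] := IHn q.
  apply/leq_sizeP => j; rewrite leq_eqVlt => /orP[/eqP <-|nj].
    rewrite coefB coefZ; have /monicP := monic_degen_ffactX R n.
    by rewrite lead_coefE size_degen_ffactX /= => ->; rewrite mulr1 subrr.
  rewrite coefB coefZ (leq_sizeP _ _ sp _ nj) [X in _ * X](_ : _ = 0).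
    by rewrite mulr0 subr0.
  by apply: nth_default; rewrite size_degen_ffactX.
exists (fun k => if k == n then p`_n else c k).
rewrite big_ord_recr /= eqxx -[LHS](subrK (p`_n *: degen_ffact 1 'X n)).
congr (_ + _); rewrite -/q cE; apply: eq_bigr => i _.
by rewrite (ltn_eqF (ltn_ord i)).
Qed.

Lemma degen_ffactX_free (R : fieldType) (n : nat) (c : nat -> R) :
  \sum_(k < n) c k *: degen_ffact 1 'X k = 0 :> {poly R} ->
  forall k, (k < n)%N -> c k = 0.
Proof.
elim: n => // n IHn; rewrite big_ord_recr /= => c0.
have cn : c n = 0.
  have := congr1 (fun p : {poly R} => p`_n) c0.
  rewrite /= coefD coefZ coef0 coef_sum big1 => [|i _]; last first.
    by rewrite coefZ nth_default ?mulr0 // size_degen_ffactX.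
  have /monicP := monic_degen_ffactX R n.
  by rewrite lead_coefE size_degen_ffactX /= => ->; rewrite add0r mulr1.
move: c0; rewrite cn scale0r addr0 => /IHn c0 k.
by rewrite ltnS leq_eqVlt => /orP[/eqP->//|/c0].
Qed.

Lemma is_degen_whitney2_exists (R : realType) (m : nat) (lam : R) :
  (0 < m)%N -> exists W, is_degen_whitney2 m lam W.
Proof.
move=> m0.
have mR k : m%:R ^+ k != 0 :> R by rewrite expf_neq0 // pnatr_eq0 -lt0n.
have sz n : (size (degen_ffact lam%:P (m%:R *: 'X + 1) n : {poly R}) <= n.+1)%N.
  elim: n => [|n IHn]; first by rewrite /degen_ffact big_ord0 size_poly1.
  rewrite /degen_ffact big_ord_recr /= -/(degen_ffact _ _ _).
  apply: leq_trans (size_polyMleq _ _) _.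
  have s2 : (size (m%:R *: 'X + 1 - lam%:P *+ n : {poly R})%R <= 2)%N.
    rewrite -addrA -polyC1 -polyCMn -polyCB -mul_polyC size_MXaddC.
    by case: ifP => // _; rewrite ltnS size_polyC leq_b1.
  have := leq_add IHn s2; rewrite addn2 => h.
  by rewrite -ltnS; case: (_ + _)%N h.
have /choice[c cP] n := degen_ffactX_span (sz n).
exists (fun n k => c n k / m%:R ^+ k) => n; rewrite {1}cP.
by apply: eq_bigr => i _; rewrite divfK.
Qed.

Lemma is_degen_whitney2_unique (R : realType) (m : nat) (lam : R) W W' :
  (0 < m)%N -> is_degen_whitney2 m lam W -> is_degen_whitney2 m lam W' ->
  forall n k, (k <= n)%N -> W n k = W' n k.
Proof.
move=> m0 hW hW' n k kn.
have mR : m%:R ^+ k != 0 :> R by rewrite expf_neq0 // pnatr_eq0 -lt0n.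
pose d j := (W n j - W' n j) * m%:R ^+ j.
have d0 : \sum_(j < n.+1) d j *: degen_ffact 1 'X j = 0 :> {poly R}.
  under eq_bigr do rewrite /d mulrBl scalerBl.
  by rewrite sumrB -hW -hW' subrr.
have /eqP := degen_ffactX_free d0 (kn : (k < n.+1)%N).
by rewrite mulf_eq0 (negPf mR) orbF subr_eq0 => /eqP.
Qed.

(* Main.v *)
(** At a natural number [N], the degenerate exponential [e^(mN+1)] equals
    [e * (1 + m G)^N] with [G = (e^m - 1) / m], so the binomial theorem expands
    [(mN+1)_{n,lam}] in the falling factorials [(N)_k] with coefficients read
    off [e * G^k / k!].  Two polynomials in [N] that agree at all natural
    numbers coincide, so these coefficients satisfy the identity that determines
    the Whitney numbers. *)
Require Import Defs.
From mathcomp Require Import all_boot all_order all_algebra.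
From mathcomp Require Import reals ring.

Set Implicit Arguments.
Unset Strict Implicit.
Unset Printing Implicit Defensive.

Import GRing.Theory Num.Theory.
Local Open Scope ring_scope.

Lemma fps_coef_sum (R : comNzRingType) (I : Type) (r : seq I) (P : pred I)
    (F : I -> fps R) (n : nat) :
  fps_coef (\sum_(i <- r | P i) F i) n = \sum_(i <- r | P i) fps_coef (F i) n.
Proof. by apply: (big_morph (fun f : fps R => fps_coef f n)). Qed.

(** A series without constant term is a multiple of t, so its [k]-th power is a multiple of t^k. *)
Lemma fps_coef_exp_lt (R : comNzRingType) (f : fps R) (k n : nat) :
  fps_coef f 0 = 0 -> (n < k)%N -> fps_coef (f ^+ k) n = 0.
Proof.
move=> f0; elim: k n => // k IHk n; rewrite ltnS => nk.
rewrite exprS fps_coefM big1 // => -[[|j] /= jn] _; first by rewrite f0 mul0r.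
by rewrite IHk ?mulr0 // (leq_trans _ nk) // ltn_subLR // addSn ltnS leq_addl.
Qed.

Lemma fps_coefM_exp_lt (R : comNzRingType) (f g : fps R) (k n : nat) :
  fps_coef f 0 = 0 -> (n < k)%N -> fps_coef (g * f ^+ k) n = 0.
Proof.
move=> f0 nk; rewrite fps_coefM big1 // => j _.
by rewrite fps_coef_exp_lt ?mulr0 // (leq_ltn_trans (leq_subr _ _)).
Qed.

Lemma degen_exp_coef0 (R : fieldType) (lam x : R) :
  fps_coef (degen_exp lam x) 0 = 1.
Proof. by rewrite /= /degen_ffact big_ord0 divr1. Qed.

(** Coefficient form of the differential equation (1 + lam t) y' = x y. *)
Lemma degen_exp_coefS (R : numFieldType) (lam x : R) (n : nat) :
  fps_coef (degen_exp lam x) n.+1 *+ n.+1 =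
  (x - lam *+ n) * fps_coef (degen_exp lam x) n.
Proof.
rewrite /= /degen_ffact big_ord_recr /= factS natrM.
have n1R : n.+1%:R != 0 :> R by rewrite pnatr_eq0.
have fR : n`!%:R != 0 :> R by rewrite pnatr_eq0 -lt0n fact_gt0.
by field; rewrite fR nat1r n1R.
Qed.

(** Both sides have constant term 1 and obey the recurrence of [degen_exp_coefS] for [x + y]. *)
Lemma degen_expD (R : numFieldType) (lam x y : R) :
  degen_exp lam (x + y) = degen_exp lam x * degen_exp lam y.
Proof.
apply/fpsP; elim=> [|n IHn].
  by rewrite fps_coefM big_ord1 !degen_exp_coef0 mulr1.
have /mulIf : n.+1%:R != 0 :> R by rewrite pnatr_eq0.
apply; rewrite !mulr_natr degen_exp_coefS IHn !fps_coefM.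
set a := fps_coef (degen_exp lam x); set b := fps_coef (degen_exp lam y).
(* Leibniz rule: the factor [n+1] splits as [j + (n+1-j)]. *)
have -> : (\sum_(j < n.+2) a j * b (n.+1 - j)%N) *+ n.+1 =
    \sum_(j < n.+2) (a j *+ j) * b (n.+1 - j)%N +
    \sum_(j < n.+2) a j * (b (n.+1 - j)%N *+ (n.+1 - j)).
  rewrite -sumrMnl -big_split; apply: eq_bigr => j _ /=.
  by rewrite mulrnAl mulrnAr -mulrnDr subnKC // -ltnS.
(* The term j = 0 of the first sum and j = n+1 of the second carry the multiplicity 0; without them
   both sums run over n+1 indices. *)
apply/esym; rewrite [X in X + _ = _]big_ord_recl [X in _ + X = _]big_ord_recr /=.
rewrite mulr0n mul0r add0r subnn mulr0n mulr0 addr0.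
rewrite mulr_sumr -big_split; apply: eq_bigr => j _ /=.
have jn : (j <= n)%N by rewrite -ltnS.
rewrite /bump /= add1n subSS subSn // !degen_exp_coefS -/(a j) -/(b _).
have -> : lam *+ n = lam *+ j + lam *+ (n - j) by rewrite -mulrnDr subnKC.
by ring.
Qed.

Lemma degen_expMn (R : numFieldType) (lam x : R) (N : nat) :
  degen_exp lam (x *+ N) = degen_exp lam x ^+ N.
Proof.
elim: N => [|N IHN]; last by rewrite mulrS exprS degen_expD IHN.
apply/fpsP => -[|n]; first by rewrite degen_exp_coef0.
by rewrite /= /degen_ffact big_ord_recl /= mulr0n subrr !mul0r.
Qed.

Lemma horner_degen_ffact (R : comNzRingType) (c x : R) (p : {poly R}) (n : nat) :
  (degen_ffact c%:P p n).[x] = degen_ffact c p.[x] n.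
Proof.
rewrite /degen_ffact horner_prod; apply: eq_bigr => i _.
by rewrite hornerD hornerN hornerMn hornerC.
Qed.

Lemma degen_ffact_nat (R : comNzRingType) (N k : nat) :
  degen_ffact (1 : R) N%:R k = (N ^_ k)%:R.
Proof.
elim: k => [|k IHk]; first by rewrite /degen_ffact big_ord0.
rewrite /degen_ffact big_ord_recr /= -/(degen_ffact _ _ _) IHk ffactnSr natrM.
(* For [N < k] the subtraction [N - k] truncates, but [N ^_ k] is already 0. *)
by case: (leqP k N) => [/natrB-> //|/ffact_small->]; rewrite !mul0r.
Qed.

Lemma poly_eq_on_nat (R : numDomainType) (p q : {poly R}) :
  (forall N : nat, p.[N%:R] = q.[N%:R]) -> p = q.
Proof.
move=> pq; apply/eqP; rewrite -subr_eq0; apply/eqP.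
(* These roots, distinct in characteristic 0, outnumber the degree of [p - q]. *)
apply: (@roots_geq_poly_eq0 _ _ [seq i%:R | i <- iota 0 (size (p - q))]).
- by apply/allP => _ /mapP[i _ ->]; rewrite rootE !hornerE pq subrr.
- by rewrite map_inj_uniq ?iota_uniq // => i j /eqP; rewrite eqr_nat => /eqP.
- by rewrite size_map size_iota.
Qed.

Lemma degen_whitney2_egf (R : numFieldType) (m : nat) (lam : R) :
  (0 < m)%N ->
  is_degen_whitney2 m lam (fun n k => fps_coef (degen_exp lam 1 *
    (k`!%:R^-1 *: (m%:R^-1 *: (degen_exp lam m%:R - 1)) ^+ k)) n * n`!%:R).
Proof.
move=> m0 n; set G := m%:R^-1 *: _.
have mR : m%:R != 0 :> R by rewrite pnatr_eq0 -lt0n.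
have fR j : j`!%:R != 0 :> R by rewrite pnatr_eq0 -lt0n fact_gt0.
have G0 : fps_coef G 0 = 0.
  by rewrite fps_coefZ fps_coefD degen_exp_coef0 subrr mulr0.
apply: poly_eq_on_nat => N.
rewrite horner_degen_ffact hornerD hornerZ hornerX hornerC horner_sum.
have -> : degen_ffact lam (m%:R * N%:R + 1) n =
    fps_coef (degen_exp lam (1 + m%:R *+ N)) n * n`!%:R.
  by rewrite /= divfK // mulr_natr addrC.
have -> : degen_exp lam (1 + m%:R *+ N) =
    \sum_(k < N.+1) (m%:R ^+ k *+ 'C(N, k)) *: (degen_exp lam 1 * G ^+ k).
  rewrite degen_expD degen_expMn -[degen_exp lam m%:R](subrKC 1).
  have -> : degen_exp lam m%:R - 1 = m%:R *: G.
    by rewrite scalerA divff // scale1r.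
  rewrite exprDn mulr_sumr; apply: eq_bigr => k _.
  by rewrite expr1n mul1r exprZn mulrnAr -scalerAr scalerMnl.
rewrite fps_coef_sum mulr_suml.
pose F k := (m%:R ^+ k *+ 'C(N, k)) * fps_coef (degen_exp lam 1 * G ^+ k) n
  * n`!%:R : R.
(* The binomial sum stops at [N], the Whitney sum at [n]. Both extend to the maximum: ['C(N, k)]
   vanishes for k > N, and the coefficient of [G ^+ k] part for k > n. *)
transitivity (\sum_(k < (maxn N n).+1) F k).
  rewrite (big_ord_widen _ F (leq_maxl N.+1 n.+1)) -maxnSS big_mkcond /=.
  apply: eq_bigr => k _; case: ltnP => // Nk.
  by rewrite /F bin_small // mulr0n !mul0r.
transitivity (\sum_(k < n.+1) F k).
  rewrite [RHS](big_ord_widen _ F (leq_maxr N.+1 n.+1)) -maxnSS [RHS]big_mkcond /=.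
  apply: eq_bigr => k _; case: ltnP => // nk.
  by rewrite /F fps_coefM_exp_lt ?mulr0 ?mul0r.
apply: eq_bigr => k _.
(* The factor k! in (N)_k = C(N,k) k! cancels the 1/k! of the coefficient. *)
rewrite hornerZ -polyC1 horner_degen_ffact hornerX degen_ffact_nat -bin_ffact.
rewrite -scalerAr fps_coefZ /F natrM -mulr_natr.
by field; exact: fR.
Qed.

Theorem theorem1 (R : realType) (m : nat) (m_gt0 : (0 < m)%N)
    (lam : R) (lam_neq0 : lam != 0) (k : nat)
    (W : nat -> nat -> R) (W_whitney : is_degen_whitney2 m lam W) :
  degen_exp lam 1 *
    (k`!%:R^-1 *: (m%:R^-1 *: (degen_exp lam m%:R - 1)) ^+ k)
  = \fps_n (if (k <= n)%N then W n k / n`!%:R else 0).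
Proof.
apply/fpsP => n; rewrite [RHS]/=; case: leqP => [kn|nk].
  rewrite (is_degen_whitney2_unique m_gt0 W_whitney
    (degen_whitney2_egf lam m_gt0) kn) mulfK //.
  by rewrite pnatr_eq0 -lt0n fact_gt0.
(* For [n < k] the left side has no t^n term, since e^m - 1 has no constant term. *)
rewrite -scalerAr fps_coefZ fps_coefM_exp_lt ?mulr0 //.
by rewrite fps_coefZ fps_coefD degen_exp_coef0 subrr mulr0.
Qed.
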